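(* For $n\ge0$, the polynomial $A_n(x,f,g,h\,|\,p,q)$ is $\gamma$-positive (in $x$) and can be expanded as $$A_n(x,f,g,h\,|\,p,q)=\sum_{k=0}^{\lfloor n/2\rfloor}\gamma^a_{n,k}(f)\,x^k(1+x)^{n-2k},$$ where $$\gamma^a_{n,k}(f)=\sum_{\sigma\in\mathfrak{S}_{n+1,\mathrm{des}=k}^{\mathrm{dd}=0}}f^{\mathrm{lmaxpk}(\sigma)-1}g^{\mathrm{rmaxpk}(\sigma)-1}h^{\mathrm{D}(\sigma)}p^{(31-2)(\sigma)}q^{(2-13)(\sigma)}.$$
   Context: $\mathfrak{S}_N$ is the set of permutations $\sigma=\sigma_1\cdots\sigma_N$ of $[N]$. With the convention $\sigma_0=\sigma_{N+1}=0$, a letter $\sigma_i$ ($i\in[N]$) is a valley if $\sigma_{i-1}>\sigma_i<\sigma_{i+1}$, a peak if $\sigma_{i-1}<\sigma_i>\sigma_{i+1}$, a double descent if $\sigma_{i-1}>\sigma_i>\sigma_{i+1}$. $\mathrm{Val}(\sigma)$, $\mathrm{Pk}(\sigma)$ are the sets of letters that are valleys, peaks; $\mathrm{dd}(\sigma)$ is the number of double descents; $\mathrm{des}(\sigma)=\#\{1\le i\le N-1:\sigma_i>\sigma_{i+1}\}$. $\mathrm{lmaxpk}(\sigma)$ (resp. $\mathrm{rmaxpk}(\sigma)$) is the number of peaks that are larger than all letters to their left (resp. right). For $\sigma\in\mathfrak{S}_N$, $\mathrm{D}(\sigma)=\sum_{i\in\mathrm{Pk}(\sigma)\setminus\{N\}}i-\sum_{j\in\mathrm{Val}(\sigma)}j$.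 $(31\!-\!2)(\sigma)$ is the number of pairs $i<j\le N$ with $\sigma_i>\sigma_j>\sigma_{i+1}$; $(2\!-\!13)(\sigma)$ is the number of pairs $i<j<N$ with $\sigma_j<\sigma_i<\sigma_{j+1}$. Define $$A_n(x,f,g,h\,|\,p,q)=\sum_{\sigma\in\mathfrak{S}_{n+1}}x^{\mathrm{des}(\sigma)}f^{\mathrm{lmaxpk}(\sigma)-1}g^{\mathrm{rmaxpk}(\sigma)-1}h^{\mathrm{D}(\sigma)}p^{(31-2)(\sigma)}q^{(2-13)(\sigma)}$$ and $\mathfrak{S}_{N,\mathrm{des}=k}^{\mathrm{dd}=0}=\{\sigma\in\mathfrak{S}_N:\mathrm{dd}(\sigma)=0,\ \mathrm{des}(\sigma)=k\}$. A polynomial $\sum_{i=0}^nh_ix^i$ with $h_i=h_{n-i}$ can be written uniquely as $\sum_{k=0}^{\lfloor n/2\rfloor}\gamma_kx^k(1+x)^{n-2k}$; it is $\gamma$-positive if all $\gamma_k$ are nonnegative, which here (coefficients being polynomials in $f,g,h,p,q$) means that each $\gamma_k$ is a polynomial in $f,g,h,p,q$ with nonnegative coefficients. *)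

(* Defs.v *)
From mathcomp Require Import all_boot all_order all_algebra all_fingroup.
From mathcomp Require Import mpoly zify.

Set Implicit Arguments.
Unset Strict Implicit.
Unset Printing Implicit Defensive.

Import Order.TTheory GRing.Theory Num.Theory.

(* The one-line word of s : 'S_N, padded as 0 = sigma_0, sigma_1, ..., sigma_N,
   0 = sigma_(N+1).  MathComp permutes {0, ..., N-1}, so that the letter in
   position i.+1 is (s i).+1, i.e. [lift ord0 (s i)]; the value ord0 is never
   a genuine letter and ord_max : 'I_N.+1 is the letter N.  A position in [N]
   is below always written i.+1 with i : 'I_N. *)
Definition letter (N : nat) (s : 'S_N) (i : nat) : 'I_N.+1 :=
  nth ord0 (ord0 :: rcons [seq lift ord0 (s j) | j <- enum 'I_N] ord0) i.

Section Statistics.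
Variables (N : nat) (s : 'S_N).
Local Notation w := (letter s).

Definition is_valley (i : nat) : bool := (w i < w i.-1) && (w i < w i.+1).
Definition is_peak (i : nat) : bool := (w i.-1 < w i) && (w i.+1 < w i).
Definition is_ddes (i : nat) : bool := (w i < w i.-1) && (w i.+1 < w i).

Definition Val : {set 'I_N.+1} := [set w i.+1 | i : 'I_N & is_valley i.+1].
Definition Pk : {set 'I_N.+1} := [set w i.+1 | i : 'I_N & is_peak i.+1].

Definition dd : nat := #|[set i : 'I_N | is_ddes i.+1]|.

Definition des : nat := #|[set i : 'I_N | (i.+1 < N) && (w i.+2 < w i.+1)]|.

Definition lmaxpk : nat :=
  #|[set i : 'I_N | is_peak i.+1 &
      [forall j : 'I_N, (j < i) ==> (w j.+1 < w i.+1)]]|.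

Definition rmaxpk : nat :=
  #|[set i : 'I_N | is_peak i.+1 &
      [forall j : 'I_N, (i < j) ==> (w j.+1 < w i.+1)]]|.

Definition D : int :=
  (\sum_(i in Pk :\ ord_max) (i : nat)%:Z - \sum_(j in Val) (j : nat)%:Z)%R.

(* (31-2) *)
Definition n31_2 : nat :=
  #|[set ij : 'I_N * 'I_N |
      (ij.1 < ij.2) && (w ij.1.+2 < w ij.2.+1 < w ij.1.+1)]|.

(* (2-13) *)
Definition n2_13 : nat :=
  #|[set ij : 'I_N * 'I_N |
      [&& ij.1 < ij.2, ij.2.+1 < N & w ij.2.+1 < w ij.1.+1 < w ij.2.+2]]|.

End Statistics.

(* The exponents D, lmaxpk - 1 and rmaxpk - 1 used in [weight] below are
   genuine: D is nonnegative (so that `|D|%N is D), and lmaxpk and rmaxpk are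
   positive (so that .-1 is not truncated). *)

Section Exponents.
Variables (N : nat) (s : 'S_N).
Local Notation w := (letter s).

Lemma letter0 : w 0 = ord0. Proof. by []. Qed.

Lemma letterS (i : 'I_N) : w i.+1 = lift ord0 (s i).
Proof.
rewrite /letter /= nth_rcons size_map size_enum_ord ltn_ord.
by rewrite (nth_map i) ?size_enum_ord // nth_ord_enum.
Qed.

Lemma letter_last : w N.+1 = ord0.
Proof. by rewrite /letter /= nth_rcons size_map size_enum_ord ltnn eqxx. Qed.

Lemma letterS_inj : injective (fun i : 'I_N => w i.+1).
Proof. by move=> i j /=; rewrite !letterS => /lift_inj /perm_inj. Qed.

Lemma letter_neq i : 0 < N -> i <= N -> (w i != w i.+1 :> nat).
Proof.
move=> N0; case: i => [|i] iN; first by rewrite (letterS (Ordinal N0)).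
have [jN|Nj] := ltnP i.+1 N; last first.
  have -> : i.+2 = N.+1 by lia.
  by rewrite letter_last (letterS (Ordinal iN)).
apply/eqP => /val_inj h.
have /(congr1 val) /= : Ordinal iN = Ordinal jN by apply: letterS_inj.
by lia.
Qed.

Let ascents m := \sum_(i < m) (w i.+1 - w i).

Lemma ascents_ge m : w m <= ascents m.
Proof.
rewrite /ascents; elim: m => [|m IH]; first by rewrite letter0.
rewrite big_ord_recr /=; move: IH; set a := (\sum_(_ < _) _); lia.
Qed.

Lemma ascents_le m k : m <= k -> ascents m <= ascents k.
Proof.
by rewrite /ascents => mk; rewrite -!(big_mkord xpredT (fun i => w i.+1 - w i))
  (big_cat_nat (leq0n m) mk) /= leq_addr.
Qed.

Lemma ascents_eq m : 0 < N -> m <= N ->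
  ascents m.+1 + \sum_(i < m | is_valley s i.+1) w i.+1 =
  \sum_(i < m | is_peak s i.+1) w i.+1
    + (if w m < w m.+1 then w m.+1 : nat else 0).
Proof.
move=> N0; rewrite /ascents; elim: m => [|m IH] mN.
  have := letter_neq N0 mN; rewrite !big_ord0 big_ord_recr big_ord0 /=.
  by case: ltnP => ?; lia.
have h0 := letter_neq N0 (ltnW mN); have h1 := letter_neq N0 mN.
have {IH} := IH (ltnW mN).
rewrite [X in _ -> X + _ = _]big_ord_recr /=.
rewrite !(big_mkcond (fun i : 'I__ => is_valley s i.+1)) /=.
rewrite !(big_mkcond (fun i : 'I__ => is_peak s i.+1)) /=.
rewrite [X in _ -> _ + X = _]big_ord_recr [X in _ -> _ = X + _]big_ord_recr /=.
rewrite /is_valley /is_peak /=.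
by case: (ltngtP (w m) (w m.+1)) h0;
  case: (ltngtP (w m.+1) (w m.+2)) h1 => /=; lia.
Qed.

Lemma sum_peaks_ge :
  \sum_(i < N | is_valley s i.+1) w i.+1 + N <=
  \sum_(i < N | is_peak s i.+1) w i.+1.
Proof.
have [N0|N0] := posnP N; first by rewrite !big1 ?N0 // => -[i iN]; exfalso; lia.
have := ascents_eq N0 (leqnn N); rewrite letter_last ltn0 addn0 => <-.
rewrite addnC leq_add2r.
have N1 : N.-1 < N by rewrite ltn_predL.
pose i := s^-1%g (Ordinal N1).
have wi : w i.+1 = N :> nat by rewrite letterS permKV /= /bump; lia.
rewrite -{1}wi; apply: leq_trans (ascents_ge _) (ascents_le _).
by rewrite ltnS ltnW.
Qed.

Lemma D_ge0 : (0 <= D s)%R.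
Proof.
have sumE (P : nat -> bool) :
    \sum_(v in [set w i.+1 | i : 'I_N & P i.+1]) (v : nat) =
    \sum_(i < N | P i.+1) w i.+1.
  rewrite big_imset /=; last by move=> i j _ _; apply: letterS_inj.
  by apply: eq_bigl => i; rewrite inE.
rewrite /D -!(big_morph _ PoszD (erefl 0%Z)) subr_ge0 lez_nat /Val sumE.
have := sum_peaks_ge; rewrite -(sumE (is_peak s)) -/(Pk s).
have [NPk|NPk] := boolP (ord_max \in Pk s).
  by rewrite (big_setD1 _ NPk) /= addnC leq_add2l.
rewrite (setDidPl _); last by rewrite disjoint_sym disjoints1.
by apply: leq_trans; rewrite leq_addr.
Qed.

End Exponents.

Section MaxPeak.
Variables (N : nat) (s : 'S_N.+1).
Local Notation w := (letter s).
Let m : 'I_N.+1 := s^-1%g ord_max.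

Lemma letter_max (i : nat) : i != m.+1 -> w i < w m.+1.
Proof.
rewrite letterS permKV /= /bump /= add1n.
case: i => [|i] neq; first by rewrite letter0.
have [iN|Ni] := ltnP i N.+1; last by rewrite /letter /= nth_rcons size_map
  size_enum_ord (leq_gtF Ni); case: ifP.
rewrite (letterS _ (Ordinal iN)) /= /bump /= add1n ltnS ltn_neqAle -ltnS ltn_ord.
rewrite andbT; apply: contraNneq neq => h.
suff -> : m = Ordinal iN by [].
by apply: (@perm_inj _ s); rewrite permKV; apply: val_inj.
Qed.

Lemma max_is_peak : is_peak s m.+1.
Proof. by rewrite /is_peak !letter_max //= neq_ltn ?ltnSn ?orbT. Qed.

Lemma lmaxpk_gt0 : 0 < lmaxpk s.
Proof.
apply/card_gt0P; exists m; rewrite inE max_is_peak /=.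
by apply/forallP => j; apply/implyP => jm; rewrite letter_max // eqSS neq_ltn jm.
Qed.

Lemma rmaxpk_gt0 : 0 < rmaxpk s.
Proof.
apply/card_gt0P; exists m; rewrite inE max_is_peak /=.
by apply/forallP => j; apply/implyP => mj;
  rewrite letter_max // eqSS neq_ltn mj orbT.
Qed.

End MaxPeak.

Local Open Scope ring_scope.

(* Polynomials in the indeterminates f, g, h, p, q. *)
Notation coefs := {mpoly int[5]}.

Definition Xf : coefs := 'X_(@Ordinal 5 0 isT).
Definition Xg : coefs := 'X_(@Ordinal 5 1 isT).
Definition Xh : coefs := 'X_(@Ordinal 5 2 isT).
Definition Xp : coefs := 'X_(@Ordinal 5 3 isT).
Definition Xq : coefs := 'X_(@Ordinal 5 4 isT).

Definition weight (N : nat) (s : 'S_N) : coefs :=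
  Xf ^+ (lmaxpk s).-1 * Xg ^+ (rmaxpk s).-1 * Xh ^+ `|D s|%N
    * Xp ^+ n31_2 s * Xq ^+ n2_13 s.

(* A_n(x, f, g, h | p, q), as a polynomial in x = 'X. *)
Definition A (n : nat) : {poly coefs} :=
  \sum_(s : 'S_n.+1) (weight s)%:P * 'X^(des s).

Definition gamma_a (n k : nat) : coefs :=
  \sum_(s : 'S_n.+1 | (dd s == 0%N) && (des s == k)) weight s.

Definition nonneg_coefs (c : coefs) : Prop := forall m, 0 <= c@_m.

(* n is the length of the expansion, i.e. the symmetry is h_i = h_(n-i). *)
Definition gamma_positive (n : nat) (P : {poly coefs}) : Prop :=
  [/\ (size P <= n.+1)%N,
      forall i, (i <= n)%N -> P`_i = P`_(n - i)
    & exists2 c : nat -> coefs,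
        P = \sum_(k < n./2.+1) (c k)%:P * 'X^k * (1 + 'X) ^+ (n - 2 * k) &
        forall k, (k <= n./2)%N -> nonneg_coefs (c k)].

(* Main.v *)
Require Import Defs.
From mathcomp Require Import all_boot all_order all_algebra.
From mathcomp Require Import all_fingroup.
From mathcomp Require Import mpoly zify.
Import GRing.Theory.
Local Open Scope ring_scope.

(** The proof is a modified Foata-Strehl action (valley hopping), used one
letter at a time.

Call a letter of a word free when it is a double ascent or a double descent
of the word padded by 0 at both ends.  A free letter v touches a maximal
nonempty block B of letters larger than v, on its left if v is a double
descent and on its right if v is a double ascent; on the other side of v, and
at the far end of B, stand letters smaller than v (possibly a padding 0).
Letting v hop over B, i.e. exchanging v B and B v, turns a double descent v
into a double ascent and back ([hop], [hop_spec]).  Nothing else changes: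

- the neighbours of another letter y change only where y meets v or an end of
  B, and there the old and the new neighbour compare with y in the same way;
  so peaks, valleys, double ascents and double descents other than v persist;
- a peak y outside B has the same letters on either side as before, and a peak
  in B is larger than v; so being a left-to-right or right-to-left maximum is
  unaffected;
- for a letter y the patterns 31-2 in which y plays 2 count the descents
  crossing the level y on the left of y.  If y < v, then v B is all above the
  level y; if y > v, then v is one more low letter next to a low letter; if
  y = v, then B crosses no level v.  So the count is unchanged, and reversing
  the words gives the same for 2-13 ([before_hop], [left_cross_hop]).

Hence the weight without its power of x is invariant ([hop_stable]), while
the factor of v in x^des is 1 for a double ascent and x for a double descent.
Pairing a word with its hop, one may therefore give v the factor 1 + x when it
is a double ascent and 0 when it is a double descent.  Doing this for the
letters v = 1, 2, ... in turn never requires hops of different letters to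
commute ([partial_expansionS]).  In the end only words without double descents
survive.  Such a word on n+1 letters with k descents has k+1 peaks, and
counting ascents and descents of the padded word leaves n-2k double ascents
([rises_falls]), so its power of x has become x^k (1+x)^(n-2k)
([full_product], [word_expansion]).

All statistics are sums over the letters y of quantities that depend only on
the part of the word before y and the part after y; this is what makes the
invariance checkable letter by letter, and the last part matches these sums
with the statistics of a permutation. *)

Set Implicit Arguments.
Unset Strict Implicit.
Unset Printing Implicit Defensive.

(** * The part of a word before a letter *)

Section LeftProfile.
Local Open Scope nat_scope.
Implicit Types (w L B R : seq nat) (y v x : nat).

Definition before y w := take (index y w) w.

(** The starting letter x makes the count additive under concatenation. *)
Definition descents_across y x w :=
  count id (pairmap (fun a b => b < y < a) x w).

(** The default 0 of [last] is the letter padded on the left. *)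
Definition rise w y := last 0 (before y w) < y.
Definition left_record w y := all (gtn y) (before y w).

(** The number of patterns 31-2 of w in which y plays the letter 2; taken in
[rev w] it is the number of patterns 2-13 in which y plays the letter 2. *)
Definition left_cross w y := descents_across y 0 (before y w).

Lemma before_cat y w1 w2 :
  before y (w1 ++ w2) = if y \in w1 then before y w1 else w1 ++ before y w2.
Proof.
rewrite /before index_cat take_cat; case: (boolP (y \in w1)) => yw1.
  by rewrite index_mem yw1.
by rewrite ltnNge leq_addr /= addKn.
Qed.

Lemma before_cons y x w :
  before y (x :: w) = if x == y then [::] else x :: before y w.
Proof. by rewrite /before /=; case: eqP. Qed.

Lemma mem_before y w z : z \in before y w -> z \in w.
Proof. exact: mem_take. Qed.

Lemma before_head y w : y \in w -> before y w = [::] -> head 0 w = y.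
Proof. by case: w => //= a w _; rewrite before_cons; case: eqP. Qed.

Lemma head_before y w : before y w != [::] -> head 0 (before y w) = head 0 w.
Proof. by case: w => // a w; rewrite before_cons; case: ifP. Qed.

Lemma last_rev x w : last x (rev w) = head x w.
Proof. by case: w => //= z w; rewrite rev_cons last_rcons. Qed.

Lemma head_rev x w : head x (rev w) = last x w.
Proof. by rewrite -last_rev revK. Qed.

Lemma descents_across_cat y x w1 w2 :
  descents_across y x (w1 ++ w2) =
  descents_across y x w1 + descents_across y (last x w1) w2.
Proof. by rewrite /descents_across pairmap_cat count_cat. Qed.

Lemma descents_across_cons y x z w :
  descents_across y x (z :: w) = (z < y < x) + descents_across y z w.
Proof. by []. Qed.

(** The starting letter matters only through its side of the level y. *)
Lemma eq_descents_across y x x' w :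
  (y < x) = (y < x') -> descents_across y x w = descents_across y x' w.
Proof. by case: w => //= z w h; rewrite !descents_across_cons h. Qed.

Lemma descents_across_high y x w :
  all (ltn y) w -> descents_across y x w = 0.
Proof.
elim: w x => //= z w IH x /andP[yz yw].
by rewrite descents_across_cons IH // (leq_gtF (ltnW yz)).
Qed.

Lemma last_high y x w : all (ltn y) w -> y < x -> y < last x w.
Proof. by elim: w x => //= z w IH x /andP[yz yw] _; apply: IH. Qed.

Lemma all_ltnW y v w : y < v -> all (ltn v) w -> all (ltn y) w.
Proof. by move=> yv; apply: sub_all => z; apply: ltn_trans. Qed.

(** * Moving a letter over a block of larger letters *)

Section Hop.
Variables (v : nat) (L B R : seq nat).
Hypotheses (Bv : all (ltn v) B) (Lv : last 0 L < v) (Rv : head 0 R < v).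
Let w1 := L ++ v :: B ++ R.
Let w2 := L ++ B ++ v :: R.

Let vB : v \notin B. Proof. by apply/negP => /(allP Bv); rewrite /= ltnn. Qed.

(** The four cases are: y in L, y = v, y in B, and y in R.  In the last one,
the part of R before y is recorded just as far as needed: either y is the
first letter of R, which is below v, or that part begins with a letter
below v. *)
Lemma before_hop y : y \in w1 ->
  [\/ before y w1 = before y w2,
   [/\ y = v, before y w1 = L & before y w2 = L ++ B],
   [/\ v < y, before y w1 = L ++ v :: before y B
     & before y w2 = L ++ before y B] |
   [/\ before y w1 = L ++ v :: B ++ before y R,
       before y w2 = L ++ B ++ v :: before y R,
       y != v & before y R = [::] /\ y < v \/
       exists2 z, z < v & exists r, before y R = z :: r]].
Proof.
rewrite /w1 /w2 !(before_cat _ L) before_cons !(before_cat _ B) before_cons.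
case: ifP => [_ _|yL]; first by constructor 1.
rewrite mem_cat yL inE mem_cat /=.
case: eqVneq => [-> _|vy] /=.
  by rewrite (negPf vB) !cats0; constructor 2.
case: ifP => yB; first by move=> _; constructor 3; split=> //; apply: (allP Bv).
move=> yR; constructor 4; split=> //.
case E : (before y R) => [|z r].
  by left; split; rewrite // -(before_head yR E).
right; exists z; last by exists r.
by rewrite -[z]/(head 0 (z :: r)) -E head_before ?E.
Qed.

Lemma rise_hop y : y \in w1 -> y != v -> rise w1 y = rise w2 y.
Proof.
move=> yw /negPf yv; rewrite /rise.
case: (before_hop yw) => [->|[/eqP]|[vy -> ->]|[-> -> _ E]] //.
- by rewrite yv.
- rewrite !last_cat /=; case: (before y B) => //=.
  by rewrite vy (ltn_trans Lv).
- rewrite !(last_cat, last_cons) /=; case: E => [[-> yltv]|[z _ [r ->]]] //=.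
  have : v <= last v B.
    by case: (B) Bv => //= b B' /andP[vb B'v]; apply/ltnW/last_high.
  by move=> ?; lia.
Qed.

Lemma left_record_hop y : y \in w1 -> y != v ->
  left_record w1 y = left_record w2 y.
Proof.
move=> yw /negPf yv; rewrite /left_record.
case: (before_hop yw) => [->|[/eqP]|[vy -> ->]|[-> -> _ E]] //.
- by rewrite yv.
- by rewrite !all_cat /= vy.
- by rewrite !all_cat /= !all_cat /=; do !case: all; case: ltnP.
Qed.

(** Only the side of the level y on which letters lie matters.  Moving v past B
either stays within a run of letters above y, or moves a letter below y from
one place next to a low letter to another such place; and no letter of B lies
below v. *)
Lemma left_cross_hop y : y \in w1 -> left_cross w1 y = left_cross w2 y.
Proof.
move=> yw; rewrite /left_cross.
case: (before_hop yw) => [->|[-> -> ->]|[vy -> ->]|[-> -> yv E]] //.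
- by rewrite descents_across_cat (@descents_across_high _ _ B) ?addn0.
- rewrite !descents_across_cat descents_across_cons; congr (_ + _).
  rewrite (@eq_descents_across _ v (last 0 L)); lia.
- rewrite !(descents_across_cat _ _ L) descents_across_cons.
  rewrite !(descents_across_cat _ _ B) descents_across_cons; congr (_ + _).
  (* y < v: the whole of v B is above the level y. *)
  have [yltv|vlty] := ltnP y v.
    have yB := all_ltnW yltv Bv.
    rewrite !(@descents_across_high _ _ B) //.
    have -> : descents_across y (last v B) (before y R) =
        descents_across y v (before y R).
      by apply: eq_descents_across; rewrite yltv last_high.
    by rewrite (leq_gtF (ltnW yltv)).
  (* v < y: v follows the low end of L, then precedes the low head of R. *)
  have {yv} {}vlty : v < y by rewrite ltn_neqAle eq_sym yv.
  case: E => [[_]|[z zv [r ->]]]; first by lia.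
  rewrite !descents_across_cons.
  rewrite (@eq_descents_across _ v (last 0 L) B); last by lia.
  have -> : (y < last v B) = (y < last (last 0 L) B).
    by case: (B) => //=; lia.
  lia.
Qed.

End Hop.

(** In front of v, the maximal run of larger letters ends at v, so it is empty
exactly when v rises. *)
Lemma rise_run v L B R : v \notin L -> all (ltn v) B -> last 0 L < v ->
  rise (L ++ B ++ v :: R) v = (B == [::]).
Proof.
move=> vL Bv Lv.
have vB : v \notin B by apply/negP => /(allP Bv); rewrite /= ltnn.
rewrite /rise catA before_cat mem_cat (negPf vL) (negPf vB).
rewrite before_cons eqxx cats0 last_cat.
case: (B) Bv => [|b B'] /=; first by rewrite Lv.
by move=> /andP[vb B'v]; rewrite ltnNge ltnW // last_high.
Qed.

(** The two runs of larger letters on either side of v are exchanged, as in the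
original Foata-Strehl action; this formula is its own inverse without any case
distinction.  For a free letter one of the runs is empty, and v jumps over the
other one.  The words l and r list the letters on each side starting from v. *)
Definition hop v w :=
  let l := rev (before v w) in
  let r := rev (before v (rev w)) in
  let i := find (gtn v) l in
  let j := find (gtn v) r in
  rev (drop i l) ++ take j r ++ v :: rev (take i l) ++ drop j r.

Lemma find_low v B R :
  all (ltn v) B -> head 0 R < v -> find (gtn v) (B ++ R) = size B.
Proof.
move=> Bv Rv; rewrite find_cat has_find.
have -> : find (gtn v) B < size B = false.
  by rewrite -has_find; apply/hasP => -[z /(allP Bv) /=]; lia.
by case: R Rv => [|z R] /=; rewrite ?addn0 // => ->; rewrite addn0.
Qed.

Lemma hopE v L B C R :
  v \notin L ++ R -> all (ltn v) B -> all (ltn v) C ->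
  last 0 L < v -> head 0 R < v ->
  hop v (L ++ B ++ v :: C ++ R) = L ++ C ++ v :: B ++ R.
Proof.
rewrite mem_cat negb_or => /andP[vL vR] Bv Cv Lv Rv.
have notin D : all (ltn v) D -> v \notin D.
  by move=> Dv; apply/negP => /(allP Dv); rewrite /= ltnn.
have lE : before v (L ++ B ++ v :: C ++ R) = L ++ B.
  by rewrite catA before_cat mem_cat (negPf vL) (negPf (notin _ Bv))
    before_cons eqxx cats0.
have rE : before v (rev (L ++ B ++ v :: C ++ R)) = rev (C ++ R).
  rewrite catA rev_cat rev_cons cat_rcons before_cat mem_rev mem_cat.
  by rewrite (negPf vR) (negPf (notin _ Cv)) before_cons eqxx cats0.
rewrite /hop lE rE revK rev_cat !find_low ?all_rev //; last first.
  by rewrite head_rev.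
by rewrite !take_size_cat // !drop_size_cat // !revK.
Qed.

Lemma split_low v w : 0 < v -> v \notin w ->
  exists B R, [/\ w = B ++ R, all (ltn v) B & head 0 R < v].
Proof.
move=> v0; elim: w => [|z w IH]; first by exists [::], [::].
rewrite inE negb_or => /andP[vz /IH[B [R [-> Bv Rv]]]].
have [zv|vltz|/eqP] := ltngtP z v; last by rewrite eq_sym (negPf vz).
  by exists [::], (z :: B ++ R).
by exists (z :: B), R; rewrite /= vltz.
Qed.

Lemma split_runs v w : 0 < v -> uniq w -> v \in w ->
  exists L B C R, [/\ w = L ++ B ++ v :: C ++ R, v \notin L ++ R,
    all (ltn v) B, all (ltn v) C & last 0 L < v /\ head 0 R < v].
Proof.
move=> v0 wU vw; case/splitPr: vw wU => l r.
rewrite cat_uniq /= negb_or => /and4P[_ /andP[vl _] vr _].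
have [C [R [rE Cv Rv]]] := split_low v0 vr.
rewrite -mem_rev in vl; have [B [L [lE Bv Lv]]] := split_low v0 vl.
exists (rev L), (rev B), C, R; split; rewrite ?all_rev //.
- by rewrite catA -rev_cat -lE revK rE.
- move: vl vr; rewrite lE rE !mem_cat mem_rev !negb_or.
  by move=> /andP[_ ->] /andP[].
- by rewrite last_rev.
Qed.

(** The letter v itself changes its neighbours, so only its crossings are
compared. *)
Definition same_profile v w t := forall y, y \in w ->
  left_cross w y = left_cross t y /\
  (y != v -> rise w y = rise t y /\ left_record w y = left_record t y).

Lemma same_profile_sym v w t :
  w =i t -> same_profile v w t -> same_profile v t w.
Proof.
move=> wt h y; rewrite -wt => /h[-> yv]; split=> // /yv[-> ->] //.
Qed.

Lemma hop_profile v L B R :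
  all (ltn v) B -> last 0 L < v -> head 0 R < v ->
  same_profile v (L ++ v :: B ++ R) (L ++ B ++ v :: R).
Proof.
move=> Bv Lv Rv y yw; split; first exact: left_cross_hop.
by move=> yv; split; [apply: rise_hop | apply: left_record_hop].
Qed.

(** Reversal exchanges the word before the hop with the word after it, so the
statement for the letters on the right is [hop_profile] read backwards. *)
Lemma hop_profile_rev v L B R :
  all (ltn v) B -> last 0 L < v -> head 0 R < v ->
  same_profile v (rev (L ++ v :: B ++ R)) (rev (L ++ B ++ v :: R)).
Proof.
move=> Bv Lv Rv; rewrite !(rev_cat L) rev_cons !rev_cat rev_cons.
rewrite cat_rcons -!catA cat_rcons.
apply: same_profile_sym; last apply: hop_profile; rewrite ?all_rev //.
- move=> y; rewrite !(mem_cat, inE, mem_rev).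
  by do !case: (_ \in _); case: (_ == _).
- by rewrite last_rev.
- by rewrite head_rev.
Qed.

(** The letter after y is the letter before y in the reversed word; so all that
concerns the right side follows from the left side. *)
Definition fall w y := rise (rev w) y.

(** The hypothesis [rise w v != fall w v] says that v is free: it is a double
ascent if it rises and a double descent if it falls. *)
Lemma hop_spec v w : 0 < v -> uniq w -> v \in w -> rise w v != fall w v ->
  [/\ hop v (hop v w) = w, perm_eq (hop v w) w,
      rise (hop v w) v = fall w v /\ fall (hop v w) v = rise w v
    & same_profile v w (hop v w) /\ same_profile v (rev w) (rev (hop v w))].
Proof.
move=> v0 wU vw.
have [L [B [C [R [wE vLR Bv Cv [Lv Rv]]]]]] := split_runs v0 wU vw.
have tE : hop v w = L ++ C ++ v :: B ++ R by rewrite wE hopE.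
have [vL vR] : v \notin L /\ v \notin R.
  by move: vLR; rewrite mem_cat negb_or => /andP[].
have rw := rise_run (C ++ R) vL Bv Lv.
have rt := rise_run (B ++ R) vL Cv Lv.
have fallE D E : all (ltn v) E -> fall (L ++ D ++ v :: E ++ R) v = (E == [::]).
  move=> Ev; rewrite /fall catA rev_cat rev_cons cat_rcons rev_cat -catA.
  rewrite rise_run ?mem_rev ?all_rev //; last by rewrite last_rev.
  by rewrite -!size_eq0 size_rev.
have pE : perm_eq (hop v w) w.
  rewrite tE wE perm_cat2l -!cat_rcons !catA perm_cat2r.
  by rewrite -!cats1 -!catA perm_catC -catA perm_catCA.
rewrite {1}tE hopE // -wE => dv; split=> //.
  by rewrite tE rt wE rw !fallE.
move: dv pE; rewrite tE {1 2}wE rw fallE //.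
case: B Bv wE {rw rt tE} => [|b B] Bv wE; case: C Cv wE => [|c C] Cv wE // _.
  by rewrite wE => pE; split; [apply: hop_profile | apply: hop_profile_rev].
rewrite wE => pE; split; apply: same_profile_sym.
- exact: perm_mem.
- exact: hop_profile.
- by move=> y; rewrite !mem_rev; apply: perm_mem.
- exact: hop_profile_rev.
Qed.

End LeftProfile.

(** * Statistics of words and their invariance *)

Section WordStatistics.
Local Open Scope nat_scope.
Implicit Types (w t : seq nat) (y v : nat).

Definition peak w y := rise w y && fall w y.
Definition valley w y := ~~ rise w y && ~~ fall w y.
Definition double_descent w y := ~~ rise w y && fall w y.

(** In the word of a permutation the largest letter is [size w]. *)
Definition word_weight w : coefs := (
  Xf ^+ (count (fun y => peak w y && left_record w y) w).-1 *
  Xg ^+ (count (fun y => peak w y && left_record (rev w) y) w).-1 *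
  Xh ^+ `|(\sum_(y <- w | peak w y && (y != size w)) y%:Z
           - \sum_(y <- w | valley w y) y%:Z)%R|%N *
  Xp ^+ (\sum_(y <- w) left_cross w y) *
  Xq ^+ (\sum_(y <- w) left_cross (rev w) y))%R.

(** The letter v is neither a peak nor a valley before or after the hop, so the
changes in its records and neighbours do not show. *)
Lemma hop_stable v w : 0 < v -> uniq w -> v \in w -> rise w v != fall w v ->
  [/\ word_weight (hop v w) = word_weight w
    & forall y, y \in w -> y != v ->
        rise (hop v w) y = rise w y /\ fall (hop v w) y = fall w y].
Proof.
move=> v0 wU vw dv; have [_ pE [rv fv] [lp rp]] := hop_spec v0 wU vw dv.
have tw := perm_mem pE.
have same y : y \in w -> y != v ->
    rise (hop v w) y = rise w y /\ fall (hop v w) y = fall w y.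
  move=> yw yv; have [_ /(_ yv)[-> _]] := lp y yw; split=> //.
  by rewrite /fall; have [|_ /(_ yv)[-> _]] := rp y; rewrite ?mem_rev.
split=> //.
have pkE y : y \in w -> peak (hop v w) y = peak w y.
  have [->|yv] := eqVneq y v; first by rewrite /peak rv fv andbC.
  by move=> yw; rewrite /peak; have [-> ->] := same y yw yv.
have vlE y : y \in w -> valley (hop v w) y = valley w y.
  have [->|yv] := eqVneq y v; first by rewrite /valley rv fv andbC.
  by move=> yw; rewrite /valley; have [-> ->] := same y yw yv.
have recE y : y \in w ->
    peak (hop v w) y && left_record (hop v w) y = peak w y && left_record w y.
  move=> yw; rewrite pkE //; have [->|yv] := eqVneq y v.
    by move: dv; rewrite /peak; do 2!case: (_ w v).
  by have [_ /(_ yv)[_ ->]] := lp y yw.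
have recrE y : y \in w ->
    peak (hop v w) y && left_record (rev (hop v w)) y =
    peak w y && left_record (rev w) y.
  move=> yw; rewrite pkE //; have [->|yv] := eqVneq y v.
    by move: dv; rewrite /peak; do 2!case: (_ w v).
  by have [|_ /(_ yv)[_ ->]] := rp y; rewrite ?mem_rev.
have pkS (P : pred nat) : (\sum_(y <- w | peak (hop v w) y && P y) y%:Z =
    \sum_(y <- w | peak w y && P y) y%:Z)%R.
  rewrite big_seq_cond [RHS]big_seq_cond; apply: eq_bigl => y.
  by case: (boolP (y \in w)) => //= yw; rewrite pkE.
have vlS : (\sum_(y <- w | valley (hop v w) y) y%:Z =
    \sum_(y <- w | valley w y) y%:Z)%R.
  rewrite big_seq_cond [RHS]big_seq_cond; apply: eq_bigl => y.
  by case: (boolP (y \in w)) => //= yw; rewrite vlE.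
have lcS : \sum_(y <- w) left_cross (hop v w) y = \sum_(y <- w) left_cross w y.
  by apply: eq_big_seq => y yw; have [->] := lp y yw.
have rcS : \sum_(y <- w) left_cross (rev (hop v w)) y =
    \sum_(y <- w) left_cross (rev w) y.
  by apply: eq_big_seq => y yw; have [|->] := rp y; rewrite ?mem_rev.
rewrite /word_weight (perm_size pE) !(seq.permP pE).
rewrite (eq_in_count recE) (eq_in_count recrE) !(perm_big _ pE) /=.
by rewrite pkS vlS lcS rcS.
Qed.

Lemma before_nth w i : uniq w -> i < size w -> before (nth 0 w i) w = take i w.
Proof. by move=> wU iw; rewrite /before index_uniq. Qed.

Lemma before_rev_nth w i : uniq w -> i < size w ->
  before (nth 0 w i) (rev w) = rev (drop i.+1 w).
Proof.
move=> wU iw; have iE : i = size w - (size w - i.+1).+1 by lia.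
rewrite {1}iE -nth_rev ?before_nth ?rev_uniq ?size_rev; try lia.
by rewrite take_rev; congr (rev (drop _ w)); lia.
Qed.

Lemma last_take w i : i <= size w -> last 0 (take i w) = nth 0 (0 :: w) i.
Proof.
case: i => [|i] iw; first by rewrite take0.
by rewrite (take_nth 0) // last_rcons.
Qed.

Lemma rise_nth w i : uniq w -> i < size w ->
  rise w (nth 0 w i) = (nth 0 (0 :: w) i < nth 0 w i).
Proof. by move=> wU iw; rewrite /rise before_nth // last_take // ltnW. Qed.

Lemma fall_nth w i : uniq w -> i < size w ->
  fall w (nth 0 w i) = (nth 0 w i.+1 < nth 0 w i).
Proof.
move=> wU iw; rewrite /fall /rise before_rev_nth // last_rev.
by rewrite -nth0 nth_drop addn0.
Qed.

Lemma before_notin y w : y \notin before y w.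
Proof.
elim: w => //= z w IH; rewrite before_cons.
by case: eqVneq => // zy; rewrite inE eq_sym (negPf zy).
Qed.

Lemma rise_max N w : 0 < N -> (forall z, z \in w -> z <= N) -> rise w N.
Proof.
move=> N0 wN; rewrite /rise.
have := mem_last 0 (before N w); rewrite inE => /predU1P[-> //|lB].
rewrite ltn_neqAle wN ?(mem_before lB) // andbT.
by apply: contraNneq (before_notin N w) => {1}<-.
Qed.

(** The padded word has [(size w).+1] adjacent pairs, each an ascent or a
descent.  The letters that rise count the ascents, since the last pair is
not one; the letters that fall count the descents, since the first is not. *)
Lemma rises_falls w : 0 < size w -> uniq w -> 0 \notin w ->
  count (rise w) w + count (fall w) w = (size w).+1.
Proof.
move=> w0 wU zw; rewrite -!sum1_count big_mkcond [X in _ + X]big_mkcond /=.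
rewrite (big_nth 0) [X in _ + X](big_nth 0) !big_mkord.
have neq i : i < (size w).-1 -> nth 0 w i != nth 0 w i.+1.
  move=> iw; have {}iw : i.+1 < size w by lia.
  by rewrite nth_uniq ?neq_ltn ?ltnSn // ltnW.
have pos i : i < size w -> 0 < nth 0 w i.
  by move=> iw; rewrite lt0n; apply: contraNneq zw => <-; rewrite mem_nth.
rewrite (eq_bigr (fun i : 'I__ =>
  nat_of_bool (nth 0 (0 :: w) i < nth 0 w i))); last first.
  by move=> i _; rewrite rise_nth //; case: ifP.
rewrite [X in _ + X](eq_bigr (fun i : 'I__ =>
  nat_of_bool (nth 0 w i.+1 < nth 0 w i))); last first.
  by move=> i _; rewrite fall_nth //; case: ifP.
case E : (size w) w0 neq pos => [//|m] _ neq pos.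
rewrite big_ord_recl [X in _ + X]big_ord_recr /= pos // nth_default ?E //.
rewrite pos // -addnA [X in _ + X]addnA -big_split /=.
rewrite (eq_bigr (fun=> 1)) ?sum1_card ?card_ord ?addn1 //.
by move=> i _; have := neq i (ltn_ord i); rewrite /bump /= add1n; case: ltngtP.
Qed.

End WordStatistics.

(** * Expansion over words *)

(** Reindexing along an involution that exchanges the domains P and Q. *)
Lemma sum_swap (T : eqType) (V : nmodType) (r : seq T) (P Q : pred T)
    (phi : T -> T) (F : T -> V) : uniq r ->
  (forall w, w \in r -> P w ->
    [/\ phi w \in r, Q (phi w), phi (phi w) = w & F (phi w) = F w]) ->
  (forall w, w \in r -> Q w -> [/\ phi w \in r, P (phi w) & phi (phi w) = w]) ->
  \sum_(w <- r | P w) F w = \sum_(w <- r | Q w) F w.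
Proof.
move=> rU hP hQ.
have pE : perm_eq [seq phi w | w <- r & P w] [seq w <- r | Q w].
  apply: uniq_perm; last 1 first.
  - move=> w; rewrite mem_filter; apply/mapP/andP => [[u]|[qw wr]].
      by rewrite mem_filter => /andP[pu ur] ->; have [] := hP u ur pu.
    have [tr pt tK] := hQ w wr qw; exists (phi w) => //.
    by rewrite mem_filter pt.
  - rewrite map_inj_in_uniq ?filter_uniq // => u w.
    rewrite !mem_filter => /andP[pu ur] /andP[pw wr] e.
    by have [_ _ <- _] := hP u ur pu; rewrite e; have [_ _ -> _] := hP w wr pw.
  - exact: filter_uniq.
rewrite -[RHS]big_filter -(perm_big _ pE) big_map big_filter /=.
rewrite big_seq_cond [RHS]big_seq_cond.
by apply: eq_bigr => w /andP[wr pw]; have [_ _ _ ->] := hP w wr pw.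
Qed.

Section Expansion.
Variable n : nat.
Let N := n.+1.
Let words := permutations (iota 1 N).

Lemma wordsP w : w \in words ->
  [/\ uniq w, size w = N & forall y, (y \in w) = (0 < y <= N)%N].
Proof.
rewrite mem_permutations => wp; split.
- by rewrite (perm_uniq wp) iota_uniq.
- by rewrite (perm_size wp) size_iota.
- by move=> y; rewrite (perm_mem wp) mem_iota; lia.
Qed.

Lemma words_max w : w \in words -> rise w N /\ fall w N.
Proof.
move=> /wordsP[wU _ wN]; split; apply: rise_max => // z.
  by rewrite wN => /andP[].
by rewrite mem_rev wN => /andP[].
Qed.

(** The letters up to m have received their final factors: 1 + x for a double
ascent and 0 for a double descent.  The other letters still carry their share
of x^des. *)
Definition letter_factor (m : nat) (w : seq nat) (y : nat) : {poly coefs} :=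
  if (y <= m)%N then
    if rise w y then (if fall w y then 'X else 1 + 'X) else (~~ fall w y)%:R
  else 'X ^+ fall w y.

(** The letter N is left out of the product: it always falls, and the number of
letters that fall, counted with the padding 0, is des + 1. *)
Definition partial_expansion m : {poly coefs} :=
  \sum_(w <- words) (word_weight w)%:P * \prod_(1 <= y < N) letter_factor m w y.

(** Hopping v = m+1 pairs the words where v is a double descent, which carry the
factor x, with those where v is a double ascent, which carry the factor 1. *)
Lemma partial_expansionS m : (m.+1 < N)%N ->
  partial_expansion m = partial_expansion m.+1.
Proof.
move=> mN; set v := m.+1.
(* The part of the summand that hopping v leaves unchanged. *)
pose H w := (word_weight w)%:P *
  \prod_(y <- index_iota 1 N | y != v) letter_factor m w y.
have vin : v \in index_iota 1 N by rewrite mem_index_iota.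
have expE k :
    (forall w y, y != v -> letter_factor k w y = letter_factor m w y) ->
    partial_expansion k = \sum_(w <- words) H w * letter_factor k w v.
  move=> hk; apply: eq_bigr => w _.
  rewrite (bigD1_seq v) ?iota_uniq //= mulrCA mulrC; congr (_ * _ * _).
  by apply: eq_bigr => y /hk ->.
rewrite (expE m) // (expE m.+1); last first.
  by move=> w y yv; rewrite /letter_factor leq_eqVlt (negPf yv).
pose dbl w := rise w v != fall w v.
rewrite (bigID dbl) [RHS](bigID dbl) /=; congr (_ + _); last first.
  apply: eq_bigr => w; rewrite negbK => /eqP dw.
  rewrite /letter_factor ltnn leqnn dw.
  by case: (fall w v).
have stable w : w \in words -> dbl w ->
    [/\ hop v w \in words, dbl (hop v w), rise (hop v w) v = ~~ rise w v,
        hop v (hop v w) = w & H (hop v w) = H w].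
  move=> ww dw; have [wU _ wN] := wordsP ww.
  have v0 : (0 < v)%N by [].
  have vw : v \in w by rewrite wN; lia.
  have [hK pE [rv fv] _] := hop_spec v0 wU vw dw.
  have [wt same] := hop_stable v0 wU vw dw.
  split=> //.
  - by rewrite mem_permutations (perm_trans pE) // -mem_permutations.
  - by rewrite /dbl rv fv eq_sym.
  - by rewrite rv; move: dw; rewrite /dbl; do 2!case: (_ w v).
  rewrite /H wt; congr (_ * _).
  rewrite big_seq_cond [RHS]big_seq_cond; apply: eq_bigr => y.
  rewrite mem_index_iota => /andP[/andP[y0 yN] yv].
  have yw : y \in w by rewrite wN y0 ltnW.
  by rewrite /letter_factor; have [-> ->] := same y yw yv.
rewrite (bigID (rise^~ v)) [RHS](bigID (rise^~ v)) /=.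
rewrite [X in _ = _ + X]big1; last first.
  move=> w /andP[dw rw]; rewrite /letter_factor leqnn (negPf rw).
  move: dw; rewrite /dbl (negPf rw).
  by case: (fall w v) => //= _; rewrite mulr0.
rewrite (eq_bigr H); last first.
  move=> w /andP[dw rw]; rewrite /letter_factor ltnn.
  by move: dw; rewrite /dbl rw; case: (fall w v) => //= _; rewrite expr0 mulr1.
rewrite [X in _ + X](eq_bigr (fun w => H w * 'X)); last first.
  move=> w /andP[dw rw]; rewrite /letter_factor ltnn.
  by move: dw; rewrite /dbl (negPf rw); case: (fall w v).
rewrite addr0 [RHS](eq_bigr (fun w => H w * (1 + 'X))); last first.
  move=> w /andP[dw rw]; rewrite /letter_factor leqnn rw.
  by move: dw; rewrite /dbl rw; case: (fall w v).
rewrite -!big_distrl /= mulrDr mulr1; congr (_ + _ * _).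
apply: (sum_swap (phi := hop v)); first exact: permutations_uniq.
- move=> w ww /andP[dw rw]; have [? dt rt ? ?] := stable w ww dw.
  by rewrite dt rt (negPf rw).
- move=> w ww /andP[dw rw]; have [? dt rt ? ?] := stable w ww dw.
  by rewrite dt rt rw.
Qed.

(** The last letter falls to the padding 0, which is not a descent. *)
Definition word_des w := (count (fall w) w).-1.
Definition word_dd w := count (double_descent w) w.

Lemma word_des_sum w : w \in words ->
  word_des w = (\sum_(1 <= y < N) fall w y)%N.
Proof.
move=> ww; have [_ fN] := words_max ww.
have pE : perm_eq w (index_iota 1 N.+1).
  by rewrite /index_iota subn1 -mem_permutations.
rewrite /word_des (seq.permP pE) -sum1_count big_mkcond /=.
rewrite big_nat_recr //= fN addn1 /=.
by apply: eq_bigr => y _; case: (fall w y).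
Qed.

Lemma rises_falls_sum w : w \in words ->
  (\sum_(1 <= y < N) rise w y + \sum_(1 <= y < N) fall w y = n)%N.
Proof.
move=> ww; have [rN fN] := words_max ww; have [wU wS wN] := wordsP ww.
have pE : perm_eq w (index_iota 1 N.+1).
  by rewrite /index_iota subn1 -mem_permutations.
have := @rises_falls w; rewrite wS wU wN => /(_ isT isT isT).
rewrite !(seq.permP pE) -!sum1_count big_mkcond [X in (_ + X)%N]big_mkcond /=.
rewrite !(big_nat_recr N) //= rN fN !addn1 addSn addnS.
by case.
Qed.

(** Without double descents every letter that falls is a peak, so the letters
other than N consist of des peaks, contributing x each, of double ascents,
contributing 1 + x each, and of valleys. *)
Lemma full_product w : w \in words ->
  \prod_(1 <= y < N) letter_factor n w y =
  if word_dd w == 0%N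
  then 'X ^+ word_des w * (1 + 'X) ^+ (n - 2 * word_des w) else 0.
Proof.
move=> ww; have [rN fN] := words_max ww; have [wU wS wN] := wordsP ww.
rewrite /word_dd -leqn0 leqNgt -has_count; case: hasP => [[v vw dv]|ndd] /=.
  have vN : v != N by apply: contraTneq dv => ->; rewrite /double_descent rN.
  rewrite (bigD1_seq v) ?iota_uniq //=; last first.
    by move: vw; rewrite wN mem_index_iota; lia.
  move: dv; rewrite /double_descent /letter_factor => /andP[/negPf -> ->] /=.
  by move: vw; rewrite wN => vw; rewrite ifT ?mul0r //; lia.
have dd0 y : (1 <= y < N)%N -> fall w y -> rise w y.
  move=> yN fy; apply: contraT => ry; case: ndd; exists y.
    by rewrite wN; lia.
  by rewrite /double_descent ry.
have -> : (n - 2 * word_des w = \sum_(1 <= y < N) (rise w y && ~~ fall w y))%N.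
  rewrite -(rises_falls_sum ww) (word_des_sum ww).
  have -> : (\sum_(1 <= y < N) rise w y =
      \sum_(1 <= y < N) fall w y +
      \sum_(1 <= y < N) (rise w y && ~~ fall w y))%N.
    rewrite -big_split /=; apply: eq_big_nat => y /dd0.
    by case: (fall w y) => // [->//|]; rewrite andbT.
  lia.
rewrite (word_des_sum ww) !expr_sum -big_split /=.
apply: eq_big_nat => y yN; rewrite /letter_factor; have -> : (y <= n)%N by lia.
have := dd0 y yN; case: (fall w y) => [->//|_].
  by rewrite mulr1.
by case: (rise w y); rewrite mul1r.
Qed.

Lemma word_expansion :
  \sum_(w <- words) (word_weight w)%:P * 'X ^+ word_des w =
  \sum_(w <- words | word_dd w == 0%N)
    (word_weight w)%:P * ('X ^+ word_des w * (1 + 'X) ^+ (n - 2 * word_des w)).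
Proof.
have <- : partial_expansion 0 =
    \sum_(w <- words) (word_weight w)%:P * 'X ^+ word_des w.
  apply: eq_big_seq => w ww; rewrite (word_des_sum ww) expr_sum; congr (_ * _).
  by apply: eq_big_nat => y /andP[y0 _]; rewrite /letter_factor leqNgt y0.
have -> : partial_expansion 0 = partial_expansion n.
  have: (n <= n)%N by [].
  elim: {1 3}n => // m IH mn.
  by rewrite -partial_expansionS ?IH // ltnW.
rewrite [RHS]big_mkcond; apply: eq_big_seq => w ww.
by rewrite full_product //; case: ifP => _ //; rewrite mulr0.
Qed.

Lemma word_des_half w :
  w \in words -> word_dd w = 0%N -> (word_des w <= n./2)%N.
Proof.
move=> ww /eqP; rewrite /word_dd -leqn0 leqNgt -has_count => /hasPn ndd.
rewrite (word_des_sum ww); have := rises_falls_sum ww.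
suff : (\sum_(1 <= y < N) fall w y <= \sum_(1 <= y < N) rise w y)%N by lia.
have [_ _ wN] := wordsP ww.
rewrite big_nat [X in (_ <= X)%N]big_nat.
apply: leq_sum => y yN; have := ndd y; rewrite wN /double_descent.
have -> : (0 < y <= N)%N by lia.
by move=> /(_ isT); do 2!case: (_ w y).
Qed.

End Expansion.

(** * Words of permutations *)

Section Words.
Local Open Scope nat_scope.
Variables (N : nat) (s : 'S_N).
Hypothesis N_gt0 : 0 < N.

Definition word : seq nat := [seq (s i).+1 | i <- enum 'I_N].

Lemma size_word : size word = N.
Proof. by rewrite size_map size_enum_ord. Qed.

Lemma nth_word (i : 'I_N) : nth 0 word i = (s i).+1.
Proof. by rewrite (nth_map i) ?size_enum_ord // nth_ord_enum. Qed.

Lemma word_uniq : uniq word.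
Proof.
by rewrite map_inj_uniq ?enum_uniq // => i j [] /val_inj /perm_inj.
Qed.

(** The default of [nth] stands for the letter padded on the right. *)
Lemma letterE i : letter s i = nth 0 (0 :: word) i :> nat.
Proof.
case: i => [//|i]; have [iN|Ni] := ltnP i N.
  by rewrite (letterS _ (Ordinal iN)) /= -[i]/(val (Ordinal iN)) nth_word.
rewrite /letter /= nth_rcons size_map size_enum_ord ltnNge Ni /=.
by rewrite nth_default ?size_word //; case: ifP.
Qed.

Lemma mem_word y : (y \in word) = (0 < y <= N).
Proof.
apply/mapP/idP => [[i _ ->]|/andP[y0 yN]]; first exact: ltn_ord.
have y1 : y.-1 < N by lia.
by exists (s^-1%g (Ordinal y1)); rewrite ?mem_enum // permKV /=; lia.
Qed.

Lemma word_perm : word \in permutations (iota 1 N).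
Proof.
rewrite mem_permutations; apply: uniq_perm; rewrite ?iota_uniq ?word_uniq //.
by move=> y; rewrite mem_word mem_iota; lia.
Qed.

Lemma sum_word (F : nat -> nat) :
  \sum_(y <- word) F y = \sum_(i < N) F (nth 0 word i).
Proof. by rewrite (big_nth 0) size_word big_mkord. Qed.

Lemma card_word (P : nat -> bool) :
  #|[set i : 'I_N | P (nth 0 word i)]| = count P word.
Proof.
rewrite cardsE cardE /enum_mem size_filter -enumT /word count_map.
apply: eq_count => i /=; rewrite -[LHS]/(P (nth 0 word i)).
by rewrite nth_word.
Qed.

Lemma letter_rise (i : 'I_N) :
  (letter s i < letter s i.+1) = rise word (nth 0 word i).
Proof. by rewrite !letterE rise_nth ?word_uniq ?size_word. Qed.

Lemma letter_drop (i : 'I_N) :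
  (letter s i.+1 < letter s i) = ~~ rise word (nth 0 word i).
Proof.
rewrite -letter_rise.
by have := letter_neq s N_gt0 (ltnW (ltn_ord i)); case: ltngtP.
Qed.

Lemma letter_fall (i : 'I_N) :
  (letter s i.+2 < letter s i.+1) = fall word (nth 0 word i).
Proof. by rewrite !letterE fall_nth ?word_uniq ?size_word. Qed.

Lemma letter_climb (i : 'I_N) :
  (letter s i.+1 < letter s i.+2) = ~~ fall word (nth 0 word i).
Proof.
rewrite -letter_fall.
by have := letter_neq s N_gt0 (ltn_ord i); case: ltngtP.
Qed.

Lemma is_peak_word (i : 'I_N) : is_peak s i.+1 = peak word (nth 0 word i).
Proof. by rewrite /is_peak letter_rise letter_fall. Qed.

Lemma is_valley_word (i : 'I_N) : is_valley s i.+1 = valley word (nth 0 word i).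
Proof. by rewrite /is_valley letter_drop letter_climb. Qed.

Lemma dd_word : dd s = word_dd word.
Proof.
rewrite /dd /word_dd -card_word; apply: eq_card => i; rewrite !inE.
by rewrite /is_ddes letter_drop letter_fall.
Qed.

(** The last position is the one where [fall] counts and [des] does not. *)
Lemma des_word : des s = word_des word.
Proof.
have lN : N.-1 < N by rewrite ltn_predL.
have E : [set i : 'I_N | fall word (nth 0 word i)] =
    Ordinal lN |:
    [set i : 'I_N | (i.+1 < N) && (letter s i.+2 < letter s i.+1)].
  apply/setP => i; rewrite !inE letter_fall -val_eqE /=.
  have [iN|] := ltnP i.+1 N.
    by rewrite andTb (_ : _ == _ = false) //; lia.
  rewrite orbF => Ni; have iE : i = N.-1 :> nat by have := ltn_ord i; lia.
  rewrite -letter_fall; have -> : letter s i.+2 = ord0.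
    by rewrite iE prednK // letter_last.
  by rewrite letterS iE eqxx.
by rewrite /word_des -card_word E cardsU1 inE /= prednK // ltnn.
Qed.

Lemma left_record_word (i : 'I_N) :
  [forall j : 'I_N, (j < i) ==> (letter s j.+1 < letter s i.+1)] =
  left_record word (nth 0 word i).
Proof.
rewrite /left_record before_nth ?word_uniq ?size_word //.
apply/forallP/(all_nthP 0) => [h j|h j].
  rewrite size_take size_word ltn_ord => ji.
  have := h (Ordinal (ltn_trans ji (ltn_ord i))); rewrite !letterE /= ji /=.
  by rewrite nth_take.
apply/implyP => ji; have := h j; rewrite size_take size_word ltn_ord.
by rewrite nth_take // !letterE; apply.
Qed.

Lemma right_record_word (i : 'I_N) :
  [forall j : 'I_N, (i < j) ==> (letter s j.+1 < letter s i.+1)] =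
  left_record (rev word) (nth 0 word i).
Proof.
rewrite /left_record before_rev_nth ?word_uniq ?size_word // all_rev.
apply/forallP/(all_nthP 0) => [h j|h j].
  rewrite size_drop size_word nth_drop => ji.
  have ijN : i.+1 + j < N by lia.
  have := h (Ordinal ijN); rewrite !letterE /=.
  by rewrite ltnS leq_addr.
apply/implyP => ij; have := h (j - i.+1); rewrite size_drop size_word nth_drop.
by rewrite subnKC // !letterE; apply; have := ltn_ord j; lia.
Qed.

Lemma lmaxpk_word :
  lmaxpk s = count (fun y => peak word y && left_record word y) word.
Proof.
rewrite -card_word; apply: eq_card => i; rewrite !inE.
by rewrite is_peak_word left_record_word.
Qed.

Lemma rmaxpk_word :
  rmaxpk s = count (fun y => peak word y && left_record (rev word) y) word.
Proof.
rewrite -card_word; apply: eq_card => i; rewrite !inE.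
by rewrite is_peak_word right_record_word.
Qed.

Lemma sum_letters (P : nat -> bool) (Q : pred nat) :
  (forall i : 'I_N, P i.+1 = Q (nth 0 word i)) ->
  (\sum_(v in [set letter s i.+1 | i : 'I_N & P i.+1]) (v : nat)%:Z =
   \sum_(y <- word | Q y) y%:Z)%R.
Proof.
move=> PQ; rewrite big_imset /=; last by move=> i j _ _; apply: letterS_inj.
rewrite [RHS](big_nth 0) size_word big_mkord.
by apply: eq_big => [i|i _]; rewrite ?inE ?PQ // letterE.
Qed.

Lemma D_word : (D s = \sum_(y <- word | peak word y && (y != size word)) y%:Z
                    - \sum_(y <- word | valley word y) y%:Z)%R.
Proof.
rewrite /D size_word; congr (_ - _)%R; last exact: (sum_letters is_valley_word).
have -> : Pk s :\ ord_max =
    [set letter s i.+1 |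
      i : 'I_N & is_peak s i.+1 && (letter s i.+1 != N :> nat)].
  apply/setP => v; rewrite !inE; apply/andP/imsetP => [[vN /imsetP[i]]|[i]].
    by rewrite inE => pi vE; exists i => //; rewrite inE pi -vE.
  rewrite inE => /andP[pi iN] ->; split => //; apply/imsetP; exists i => //.
  by rewrite inE.
apply: (sum_letters
  (P := fun i => is_peak s i && (letter s i != N :> nat))) => i.
by rewrite is_peak_word letterE.
Qed.

Lemma descents_acrossE y w : (descents_across y 0 w =
  \sum_(i < (size w).-1) (nth 0 w i.+1 < y < nth 0 w i)).
Proof.
case: w => [|x w]; first by rewrite big_ord0.
rewrite descents_across_cons ltn0 andbF add0n /=.
rewrite /descents_across -sum1_count (big_nth false) big_mkord size_pairmap.
rewrite big_mkcond; apply: eq_bigr => i _.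
by rewrite (nth_pairmap 0) //=; case: ifP.
Qed.

(** The pairs counted with first index just before the position of y would need
y > y, so they may be left out: only pairs strictly before y remain. *)
Lemma n31_2_word : n31_2 s = \sum_(y <- word) left_cross word y.
Proof.
rewrite sum_word /n31_2 -sum1dep_card.
rewrite -(pair_big_dep xpredT (fun i j : 'I_N => (i < j) &&
  (letter s i.+2 < letter s j.+1 < letter s i.+1)) (fun _ _ => 1)) /=.
rewrite (exchange_big_dep xpredT) //=; apply: eq_bigr => j _.
rewrite /left_cross before_nth ?word_uniq ?size_word // descents_acrossE.
rewrite size_take size_word ltn_ord.
have jN : j.-1 <= N by have := ltn_ord j; lia.
rewrite (big_ord_widen N (fun i =>
  nat_of_bool (nth 0 (take j word) i.+1 < nth 0 word j
    < nth 0 (take j word) i)) jN).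
rewrite big_mkcond [RHS]big_mkcond; apply: eq_bigr => i _.
rewrite !letterE /=; have [ij|ji] := ltnP i j.-1.
  have ij1 : i.+1 < j by lia.
  by rewrite !nth_take ?(ltnW ij1) //; case: (_ && _).
case: ltnP => //= ij; have -> : j = i.+1 :> nat by lia.
by rewrite ltnn.
Qed.

Lemma descents_across_rev y w : descents_across y 0 (rev w) =
  \sum_(i < (size w).-1) (nth 0 w i < y < nth 0 w i.+1).
Proof.
rewrite descents_acrossE size_rev (reindex_inj rev_ord_inj) /=.
apply: eq_bigr => i _; have iw := ltn_ord i.
rewrite !nth_rev; try lia.
by congr (nat_of_bool (nth 0 w _ < y < nth 0 w _)); lia.
Qed.

Lemma n2_13_word : n2_13 s = \sum_(y <- word) left_cross (rev word) y.
Proof.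
rewrite sum_word /n2_13 -sum1dep_card.
rewrite -(pair_big_dep xpredT (fun i j : 'I_N => [&& i < j, j.+1 < N &
  letter s j.+1 < letter s i.+1 < letter s j.+2]) (fun _ _ => 1)) /=.
apply: eq_bigr => i _; have iN := ltn_ord i.
rewrite /left_cross before_rev_nth ?word_uniq ?size_word // descents_across_rev.
rewrite size_drop size_word.
pose F j := nat_of_bool
  [&& i < j, j.+1 < N & nth 0 word j < nth 0 word i < nth 0 word j.+1].
transitivity (\sum_(0 <= j < N) F j).
  rewrite big_mkord big_mkcond; apply: eq_bigr => j _.
  by rewrite /F !letterE /=; case: ifP.
rewrite (big_cat_nat (n := i.+1)) //= big_nat big1 ?add0n => [|j]; last first.
  by rewrite /F => /andP[_]; rewrite ltnS leqNgt => /negPf ->.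
rewrite -{1}[i.+1]add0n big_addn big_mkord.
have le : (N - i.+1).-1 <= N - i.+1 by lia.
rewrite (big_ord_widen _ (fun k => nat_of_bool (nth 0 (drop i.+1 word) k <
  nth 0 word i < nth 0 (drop i.+1 word) k.+1)) le).
rewrite [RHS]big_mkcond; apply: eq_bigr => j _.
rewrite /F !nth_drop [j + _]addnC [i.+1 + j.+1]addnS.
have -> : i < i.+1 + j by lia.
have -> : ((i.+1 + j).+1 < N) = (j < (N - i.+1).-1) by lia.
by case: (j < _).
Qed.

End Words.

(** * Expansion over permutations and gamma-positivity *)

Section Bridge.
Variable n : nat.

Lemma weight_word (s : 'S_n.+1) : weight s = word_weight (word s).
Proof.
by rewrite /weight /word_weight lmaxpk_word // rmaxpk_word // D_word //
  n31_2_word // n2_13_word.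
Qed.

Lemma word_inj : injective (@word n.+1).
Proof.
move=> s t st; apply/permP => i; apply: val_inj; apply: succn_inj.
by rewrite -!nth_word st.
Qed.

(** Permutations are in bijection with their words: the map is injective and
both sides have (n+1)! elements. *)
Lemma sum_perm_words (V : nmodType) (P : pred (seq nat)) (F : seq nat -> V) :
  \sum_(s : 'S_n.+1 | P (word s)) F (word s) =
  \sum_(w <- permutations (iota 1 n.+1) | P w) F w.
Proof.
rewrite -(big_map (@word n.+1) P F); apply: perm_big.
have mU : uniq [seq word s | s <- index_enum 'S_n.+1].
  by rewrite (map_inj_uniq word_inj) index_enum_uniq.
apply: uniq_perm; rewrite ?permutations_uniq //.
have sub : {subset [seq word s | s <- index_enum 'S_n.+1] <=
    permutations (iota 1 n.+1)}.
  by move=> w /mapP[s _ ->]; apply: word_perm.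
have [|_ //] := uniq_min_size mU sub.
rewrite size_map size_permutations ?iota_uniq // size_iota.
by rewrite -card_Sn -[index_enum _]enumT -cardT.
Qed.

Lemma A_expansion :
  A n = \sum_(k < n./2.+1) (gamma_a n k)%:P * 'X^k * (1 + 'X) ^+ (n - 2 * k).
Proof.
transitivity (\sum_(s : 'S_n.+1 | dd s == 0%N)
    (weight s)%:P * ('X ^+ des s * (1 + 'X) ^+ (n - 2 * des s))).
  transitivity (\sum_(s : 'S_n.+1)
      (word_weight (word s))%:P * 'X^(word_des (word s))).
    by apply: eq_bigr => s _; rewrite weight_word des_word.
  rewrite (sum_perm_words xpredT
    (fun w => (word_weight w)%:P * 'X^(word_des w))) word_expansion.
  rewrite -(sum_perm_words (fun w => word_dd w == 0%N)
    (fun w => (word_weight w)%:P *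
      ('X ^+ word_des w * (1 + 'X) ^+ (n - 2 * word_des w)))).
  by apply: eq_big => s; rewrite ?dd_word // weight_word des_word.
rewrite (partition_big (fun s => inord (des s) : 'I_n./2.+1) xpredT) //=.
apply: eq_bigr => k _; rewrite -mulrA rmorph_sum big_distrl /=.
have desE (s : 'S_n.+1) : dd s == 0%N -> (inord (des s) == k) = (des s == k).
  rewrite dd_word // => /eqP s0; rewrite -val_eqE /= inordK // ltnS des_word //.
  by apply: word_des_half s0; apply: word_perm.
apply: eq_big => s; first by case: (boolP (dd s == 0%N)) => //= /desE.
by case/andP=> s0; rewrite desE // => /eqP ->.
Qed.

End Bridge.

(** Each weight is a monomial. *)
Lemma gamma_a_nonneg n k : nonneg_coefs (gamma_a n k).
Proof.
have mono (s : 'S_n.+1) : exists m, weight s = 'X_[m].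
  have pw i e : exists m, 'X_i ^+ e = 'X_[m] :> coefs.
    by exists (U_(i) *+ e)%MM; rewrite mpolyXn.
  have mul (a b : coefs) : (exists m, a = 'X_[m]) -> (exists m, b = 'X_[m]) ->
      exists m, a * b = 'X_[m].
    by move=> [m1 ->] [m2 ->]; exists (m1 + m2)%MM; rewrite mpolyXD.
  by rewrite /weight; do 4![apply: (mul); last exact: pw]; apply: pw.
move=> m; rewrite /gamma_a raddf_sum /=.
apply: Num.Theory.sumr_ge0 => s _; have [m' ->] := mono s.
by rewrite mcoeffX Num.Theory.ler0n.
Qed.

(** Each x^k (1+x)^(n-2k) has degree n-k and is symmetric about n/2. *)
Lemma gamma_expansion_size_sym (R : comNzRingType) n (c : nat -> R) :
  let P := \sum_(k < n./2.+1) (c k)%:P * 'X^k * (1 + 'X) ^+ (n - 2 * k) in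
  (size P <= n.+1)%N /\ forall i, (i <= n)%N -> P`_i = P`_(n - i).
Proof.
have coefT k i : (k <= n./2)%N ->
    ((c k)%:P * 'X^k * (1 + 'X) ^+ (n - 2 * k))`_i =
    if (i < k)%N then 0 else c k *+ 'C(n - 2 * k, i - k).
  move=> kn; rewrite -mulrA coefCM coefXnM.
  case: ifP => _; first by rewrite mulr0.
  rewrite addrC exprD1n.
  under eq_bigr do rewrite -scaler_nat.
  rewrite -(poly_def _ (fun j => 'C(n - 2 * k, j)%:R)) coef_poly.
  by case: ltnP => // ?; [rewrite mulr_natr | rewrite mulr0 bin_small].
split=> [|i iN].
  apply/leq_sizeP => j nj; rewrite coef_sum big1 // => k _.
  have kn := ltn_ord k; rewrite coefT //.
  by case: ifP => // _; rewrite bin_small //; lia.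
rewrite !coef_sum; apply: eq_bigr => k _.
have kn := ltn_ord k; rewrite !coefT //.
have [ik|ki] := ltnP i k; have [nik|kni] := ltnP (n - i) k => //.
- by rewrite bin_small //; lia.
- by rewrite bin_small //; lia.
rewrite -bin_sub; last by lia.
by congr (_ *+ 'C(_, _)); lia.
Qed.

Theorem theorem2p4 (n : nat) :
  gamma_positive n (A n) /\
  A n = \sum_(k < n./2.+1) (gamma_a n k)%:P * 'X^k * (1 + 'X) ^+ (n - 2 * k).
Proof.
split; last exact: A_expansion.
have [sizeA symA] := gamma_expansion_size_sym n (gamma_a n).
rewrite -A_expansion in sizeA symA; split=> //.
exists (gamma_a n); first exact: A_expansion.
by move=> k _; apply: gamma_a_nonneg.
Qed.
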